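(* Let $f\in\mathbb{C}[z]$ be a polynomial of degree $n\ge1$ with $f(0)\neq0$. For every $\theta\in\mathbb{T}$, $$N_\theta(f)\le\sqrt{2}\,\sqrt{\mathcal{H}[f]}\;n,$$ and in particular $N_+(f)\le\sqrt2\sqrt{\mathcal{H}[f]}\,n$ and $N_-(f)\le\sqrt2\sqrt{\mathcal{H}[f]}\,n$. These inequalities are sharp: the constant $\sqrt2$ cannot be replaced by any smaller constant.
   Context: $\mathbb{T}=\mathbb{R}/\mathbb{Z}$. Writing $f(z)=\sum_{k=0}^na_kz^k$, the height is $\mathcal{H}[f]=\frac1n\log\frac{\max_{|z|=1}|f(z)|}{\sqrt{|a_0a_n|}}$. $N_\theta(f)$ is the number of roots (with multiplicity) of $f$ of the form $re^{2\pi i\theta}$ with $r>0$; $N_+(f)$ and $N_-(f)$ are the numbers of positive and negative real roots of $f$ (with multiplicity). *)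

(* Defs.v *)
From HB Require Import structures.
From mathcomp Require Import all_boot all_order all_algebra.
From mathcomp Require Import all_classical all_reals all_analysis.
From mathcomp.real_closed Require Import complex.
Set Implicit Arguments. Unset Strict Implicit. Unset Printing Implicit Defensive.
Import Order.TTheory GRing.Theory Num.Theory.
Local Open Scope ring_scope.
Local Open Scope complex_scope.

Section Defs.
Variable R : realType.

Definition expi (theta : R) : R[i] :=
  (cos (2 * pi * theta)) +i* (sin (2 * pi * theta)).

Definition on_ray (theta : R) (z : R[i]) : bool :=
  `[< exists2 r : R, 0 < r & z = r%:C * expi theta >].

(* the multiset of roots (with multiplicity) of f, from the factorization
   f = lead_coef f * prod_(z <- roots) (X - z) over the algebraically closed R[i] *)
Definition roots_ms (f : {poly R[i]}) : seq R[i] :=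
  sval (closed_field_poly_normal f).

Definition Ntheta (theta : R) (f : {poly R[i]}) : nat :=
  count (on_ray theta) (roots_ms f).

Definition Npos (f : {poly R[i]}) : nat :=
  count (fun z : R[i] => (complex.Im z == 0) && (0 < complex.Re z)) (roots_ms f).
Definition Nneg (f : {poly R[i]}) : nat :=
  count (fun z : R[i] => (complex.Im z == 0) && (complex.Re z < 0)) (roots_ms f).

Definition cabs (z : R[i]) : R := complex.Re `|z|.

(* max_{|z|=1} |f(z)| (a maximum by compactness, written as a sup) *)
Definition maxT (f : {poly R[i]}) : R :=
  sup [set cabs f.[z] | z in [set z : R[i] | cabs z = 1]].

Definition height (f : {poly R[i]}) : R :=
  ((size f).-1%:R)^-1 *
    ln (maxT f / Num.sqrt (cabs (f`_0 * lead_coef f))).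

End Defs.

(* Main.v *)
Require Import Defs.
From HB Require Import structures.
From mathcomp Require Import all_boot all_order all_algebra.
From mathcomp Require Import all_classical all_reals all_analysis.
From mathcomp.real_closed Require Import complex.
From mathcomp Require Import cyclic separable cyclotomic.
From mathcomp Require Import ring lra zify.
Import Order.TTheory GRing.Theory Num.Theory.
Local Open Scope ring_scope.

(** Upper bound: replacing each root w by w/|w| does not increase
max_{|z|=1} |f(z)| / sqrt|a_0 a_n|, because
|z - w/|w||^2 <= |z - w|^2 / |w| on the unit circle.  After a rotation one gets
a monic polynomial of degree n, bounded by B on the circle, with a zero of
order N at 1.  Its L^2 norm is at least the minimum over the monic polynomials
(X - 1)^N h of degree n, which is
(n - N)! (n + N)! / n!^2 >= exp (N^2 / (n + 1/2));
applying this to the k-th powers and letting k tend to infinity gives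
B^2 >= exp (N^2 / n).

Sharpness: the L^2 minimizer itself has |a_0 / a_n| = N/n, and by Cauchy-Schwarz
its maximum on the circle exceeds its L^2 norm by a factor of at most
sqrt (n + 1).  Taking n = (l + 1) N with l, then N, large, all the losses
are negligible. *)

(** * Finite differences and powers of X - 1 *)

(** Translation preserves the leading coefficient, so each difference lowers the degree. *)
Lemma size_comp_XaddC_sub {F : idomainType} (c : F) (s : {poly F}) k :
  (size s <= k.+1)%N -> (size (s \Po ('X + c%:P) - s)%R <= k)%N.
Proof.
move=> ss; apply/leq_sizeP => j; rewrite leq_eqVlt => /orP[/eqP<-|ltkj]; last first.
  rewrite coefB !nth_default ?subr0 //; first exact: leq_trans ss ltkj.
  by rewrite size_comp_poly2 ?size_XaddC //; apply: leq_trans ss ltkj.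
have [sk|sk] := leqP (size s) k.
  by rewrite coefB !nth_default ?subr0 // size_comp_poly2 ?size_XaddC.
have es : size s = k.+1 by apply/eqP; rewrite eqn_leq ss.
have := lead_coef_comp s (q := 'X + c%:P).
rewrite size_XaddC => /(_ isT).
rewrite lead_coefXaddC expr1n mulr1 !lead_coefE size_comp_poly2 ?size_XaddC //.
by rewrite coefB es /= => ->; rewrite subrr.
Qed.

(** Summation by parts moves each factor X - 1 onto s, where it acts as a forward difference; N of
    them annihilate s. *)
Lemma sum_coef_XsubC1_exp_mul {F : idomainType} (N K : nat) (h s : {poly F}) :
  (size s <= N)%N -> (size (('X - 1) ^+ N * h)%R <= K)%N ->
  \sum_(k < K) (('X - 1) ^+ N * h)`_k * s.[k%:R] = 0.
Proof.
elim: N s => [|N IHN] s.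
  rewrite leqn0 size_poly_eq0 => /eqP-> _; apply: big1 => k _.
  by rewrite horner0 mulr0.
move=> ss; rewrite exprS -mulrA; set b := _ ^+ N * h => sK.
have [->|b0] := eqVneq b 0.
  by rewrite mulr0; apply: big1 => k _; rewrite coef0 mul0r.
(* Hence the coefficient of b of index K - 1 vanishes, and summation by parts leaves no boundary
   term. *)
have sb : (size b < K)%N.
  move: sK; rewrite mulrC mulrBr mulr1 mulrC.
  have -> : 'X * b - b = b * ('X - 1%:P) by rewrite mulrBr mulrC polyC1 mulr1.
  by rewrite size_Mmonic ?monicXsubC // size_XsubC addn2.
rewrite -[RHS](IHN _ (size_comp_XaddC_sub 1 _ _ ss) (ltnW sb)) -/b.
case: K sK sb {IHN} => // K sK sb.
rewrite big_ord_recl /= mulrBl mul1r coefB coefXM /= sub0r.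
under eq_bigr => i _ do rewrite coefB coefXM /= /bump /= add1n add0n mulrBl.
rewrite sumrB big_ord_recr /= (@nth_default _ _ b K) // mul0r addr0.
under [RHS]eq_bigr => i _ do rewrite hornerD hornerN horner_comp !hornerE natr1 mulrBr.
rewrite sumrB addrCA mulNr -opprD; congr (_ - _).
have := @big_ord_recl F 0 +%R K (fun i : 'I_K.+1 => b`_i * s.[i%:R]).
by rewrite big_ord_recr /= (@nth_default _ _ b K) // mul0r addr0 => ->.
Qed.

(** Multiplying by X - 1 turns coefficients s(t) into s(t - 1) - s(t). Each such difference costs
    one degree and one index at the bottom of the range. *)
Lemma coef_XsubC1_exp_mul {F : idomainType} (N L : nat) (w s : {poly F}) :
  (forall t, (t < L)%N -> w`_t = s.[t%:R]) -> (size s <= 2 * N)%N ->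
  exists2 q : {poly F}, (size q <= N)%N &
    forall t, (N <= t < L)%N -> (('X - 1) ^+ N * w)`_t = q.[t%:R].
Proof.
move=> ws ss.
suff H k : (k <= 2 * N)%N ->  exists2 q : {poly F}, (size q <= 2 * N - k)%N &
    forall t, (k <= t < L)%N -> (('X - 1) ^+ k * w)`_t = q.[t%:R].
  by have [|q sq qE] := H N; [lia | exists q => //; apply: leq_trans sq _; lia].
elim: k => [_|k IHk lk].
  by exists s => [|t /andP[_ tL]]; rewrite ?subn0 // expr0 mul1r ws.
have [|q sq qE] := IHk; first lia.
exists (q \Po ('X + (-1)%:P) - q).
  by apply: size_comp_XaddC_sub; apply: leq_trans sq _; lia.
case=> // t /andP[kt tL]; rewrite exprS -mulrA mulrBl mul1r coefB coefXM /=.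
rewrite !qE; [|lia..].
by rewrite hornerD hornerN horner_comp !hornerE -natr1 addrK.
Qed.

Lemma coef_XsubC1_exp_mul_lead {F : idomainType} (N m : nat) (h : {poly F}) :
  (size h <= m.+1)%N -> (('X - 1) ^+ N * h)`_(m + N) = h`_m.
Proof.
rewrite -polyC1 => sh; have mon : ('X - 1%:P) ^+ N \is @monic F by rewrite monic_exp ?monicXsubC.
have [->|h0] := eqVneq h 0; first by rewrite mulr0 !coef0.
have sp : size (('X - 1%:P) ^+ N * h) = (N + size h)%N.
  by rewrite size_monicM // size_exp_XsubC.
have [hm|mh] := leqP (size h) m.
  by rewrite !nth_default // sp; lia.
have e : size h = m.+1 by apply/eqP; rewrite eqn_leq sh.
have := lead_coef_monicM h mon; rewrite !lead_coefE sp e.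
by rewrite addnS /= addnC.
Qed.

(** * The L^2 minimizer *)

(* At t = k + N with 0 <= k <= m this is, up to a constant factor, the k-th
coefficient of the minimizer's cofactor P (minimizer = (X - 1)^N P); the other
zeros make that formula valid for all -N <= k < m + N. *)
Definition gap_poly (R : nzRingType) (m N : nat) : {poly R} :=
  \prod_(i < N) ('X - i%:R%:P) *
  \prod_(i < N.-1) ((m + N + i.+1)%:R%:P - 'X).

Lemma size_prod_linear_leq {F : idomainType} (n : nat) (p : 'I_n -> {poly F}) :
  (forall i, size (p i) <= 2)%N -> (size (\prod_i p i)%R <= n.+1)%N.
Proof.
move=> p2; apply: leq_trans (size_poly_prod_leq _ _) _.
have : (\sum_(i < n) size (p i) <= \sum_(i < n) 2)%N by apply: leq_sum.
by rewrite sum_nat_const !card_ord leq_subLR => H; apply: leq_ltn_trans H _; lia.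
Qed.

Lemma size_gap_poly {F : idomainType} (m N : nat) :
  (0 < N)%N -> (size (gap_poly F m N) <= 2 * N)%N.
Proof.
move=> N0; apply: leq_trans (size_polyMleq _ _) _.
have s1 : (size (\prod_(i < N) ('X - i%:R%:P) : {poly F})%R <= N.+1)%N.
  by apply: size_prod_linear_leq => i; rewrite size_XsubC.
have s2 : (size (\prod_(i < N.-1) ((m + N + i.+1)%:R%:P - 'X) : {poly F})%R <= N.-1.+1)%N.
  by apply: size_prod_linear_leq => i; rewrite -size_polyN opprB size_XsubC.
by rewrite -subn1 leq_subLR; apply: leq_trans (leq_add s1 s2) _; lia.
Qed.

Lemma gap_polyE {F : numFieldType} (m N k : nat) : (0 < N)%N -> (k <= m)%N ->
  (gap_poly F m N).[(k + N)%:R] =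
  ((k + N) ^_ N * (m - k + N.-1) ^_ N.-1)%:R.
Proof.
move=> N0 km; rewrite /gap_poly hornerM !horner_prod natrM; congr (_ * _).
  rewrite ffact_prod natr_prod; apply: eq_bigr => i _.
  by rewrite !hornerE natrB //; have := ltn_ord i; lia.
(* The factors of the second product increase with i, those of the falling factorial decrease. *)
rewrite ffact_prod natr_prod (reindex_inj rev_ord_inj); apply: eq_bigr => i _ /=.
rewrite !hornerE -natrB; last lia.
by congr _%:R; have := ltn_ord i; lia.
Qed.

Lemma gap_poly0 {F : numFieldType} (m N t : nat) :
  (t < N)%N || (m + N < t < m + 2 * N)%N -> (gap_poly F m N).[t%:R] = 0.
Proof.
rewrite /gap_poly hornerM !horner_prod => /orP[tN|mt].
  by rewrite (bigD1 (Ordinal tN)) //= !hornerE subrr !mul0r.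
have lt : (t - (m + N).+1 < N.-1)%N by lia.
apply/eqP; rewrite mulf_eq0; apply/orP; right; apply/prodf_eq0.
exists (Ordinal lt) => //=; rewrite !hornerE subr_eq0 eqr_nat; lia.
Qed.

(** The first point past the zeros m + N < t < m + 2N; its value yields the indicator term in
    [dual_poly_exists]. *)
Lemma gap_poly_end {F : numFieldType} (m N : nat) : (0 < N)%N ->
  (gap_poly F m N).[(m + 2 * N)%:R] =
  (-1) ^+ N.-1 * ((m + 2 * N) ^_ N * N.-1`!)%:R.
Proof.
move=> N0; rewrite /gap_poly hornerM !horner_prod natrM mulrCA; congr (_ * _).
  rewrite ffact_prod natr_prod; apply: eq_bigr => i _.
  by rewrite hornerXsubC natrB //; have := ltn_ord i; lia.
rewrite -ffactnn ffact_prod natr_prod -[in (-1) ^+ _](card_ord N.-1) -prodr_const -big_split /=.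
apply: eq_bigr => i _; rewrite hornerD hornerN hornerX hornerC mulN1r -opprB.
rewrite -natrB; last by have := ltn_ord i; lia.
by congr (- _%:R); have := ltn_ord i; lia.
Qed.

(* The coefficients of (X - 1)^N P are N-th differences of a polynomial of degree
2N - 1, except for the leading one: so they are the values of a polynomial of
degree < N, plus a multiple of the indicator of k = m + N. Values of a
polynomial of degree < N are orthogonal to the coefficients of (X - 1)^N h. *)
Lemma dual_poly_exists {F : numFieldType} (m N : nat) : (0 < N)%N ->
  exists P : {poly F}, [/\ P \is monic, size P = m.+1,
    P`_0 = N%:R / (m + N)%:R, forall k, P`_k \is Num.real &
    forall h : {poly F}, (size h <= m.+1)%N ->
      \sum_(k < (m + N).+1)
        (('X - 1) ^+ N * h)`_k * (('X - 1) ^+ N * P)`_k =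
      h`_m * (((m + 2 * N) ^_ N)%:R / ((m + N) ^_ N)%:R)].
Proof.
move=> N0; set r := gap_poly F m N.
pose phi k : F := ((k + N) ^_ N * (m - k + N.-1) ^_ N.-1)%:R.
have phim : phi m = ((m + N) ^_ N * N.-1`!)%:R by rewrite /phi subnn add0n ffactnn.
have phim0 : phi m != 0.
  by rewrite phim pnatr_eq0 -lt0n muln_gt0 ffact_gt0 fact_gt0 andbT; lia.
pose P' := \poly_(k < m.+1) phi k.
have sP' : size P' = m.+1 by rewrite size_poly_eq.
exists ((phi m)^-1 *: P'); split.
- by rewrite monicE lead_coefZ lead_coefE sP' coef_poly ltnSn mulVf.
- by rewrite size_scale // invr_eq0.
- rewrite coefZ coef_poly phim /phi add0n ffactnn subn0 mulrC.
  case: N N0 {r phi phim phim0 P' sP'} => // N _ /=.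
  rewrite factS addnS ffactSS !natrM; field.
  by rewrite -natrD nat1r !pnatr_eq0 -!lt0n ffact_gt0 fact_gt0 leq_addl.
- move=> k; rewrite coefZ coef_poly.
  by apply: rpredM; [rewrite rpredV|case: ifP]; rewrite ?rpred0 ?realn.
move=> h sh.
(* The coefficient of index k of (X - 1)^N P' is read off at t = k + N, so k <= m + N requires t up
   to m + 2N. *)
pose L := (m + 2 * N).+1.
have [||q sq qE] := @coef_XsubC1_exp_mul F N L (\poly_(t < L) r.[t%:R]) r.
- by move=> t tL; rewrite coef_poly tL.
- exact: size_gap_poly.
(* Apart from the coefficients of P', shifted by N, the only nonzero value of r below L is at t = m
   + 2N. *)
have wE : \poly_(t < L) r.[t%:R] = P' * 'X^N + r.[(m + 2 * N)%:R] *: 'X^(m + 2 * N).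
  apply/polyP => t; rewrite coef_poly coefD coefMXn coefZ coefXn coef_poly.
  have [tL|tL] := ltnP t L; last first.
    rewrite !ifN; [|lia..]; have /negPf-> : t != (m + 2 * N)%N by lia.
    by rewrite mulr0 addr0.
  case: ltnP => tN.
    by rewrite gap_poly0 ?tN //; have /negPf-> : t != (m + 2 * N)%N; [lia|rewrite mulr0 addr0].
  case: ltnP => tm.
    have /negPf-> : t != (m + 2 * N)%N by lia.
    by rewrite mulr0 addr0 /phi -gap_polyE ?subnK.
  have [->|tn] := eqVneq t (m + 2 * N)%N; first by rewrite mulr1 add0r.
  by rewrite mulr0 addr0 gap_poly0 //; lia.
(* The extra monomial reaches these indices only through the constant term (-1)^N of (X - 1)^N, at k
   = m + N. *)
have GE k : (k < (m + N).+1)%N -> (('X - 1) ^+ N * P')`_k =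
    q.[(k + N)%:R] - (k == m + N)%N%:R * (r.[(m + 2 * N)%:R] * (-1) ^+ N).
  move=> kn; rewrite -qE; last by rewrite /L; lia.
  rewrite wE mulrDr coefD [_ * (P' * _)]mulrA coefMXn ltnNge leq_addl /=.
  rewrite addnK -scalerAr coefZ coefMXn.
  have [->|kmn] := eqVneq k (m + N)%N.
    rewrite ifN; last lia.
    have -> : (m + N + N - (m + 2 * N) = 0)%N by lia.
    have -> : (('X - 1) ^+ N)`_0 = (-1) ^+ N :> F by rewrite -horner_coef0 !hornerE.
    by rewrite mul1r addrK.
  by rewrite ifT ?mulr0 ?mul0r ?subr0 ?addr0 //; lia.
under eq_bigr => k _.
  rewrite -scalerAr coefZ GE // mulrCA mulrBr.
over.
rewrite -mulr_sumr sumrB [X in _ - X]big_ord_recr /= eqxx [X in _ - (X + _)]big1 ?add0r; last first.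
  by move=> i _; rewrite ltn_eqF ?mul0r ?mulr0.
rewrite (eq_bigr (fun k : 'I__ =>
  (('X - 1) ^+ N * h)`_k * (q \Po ('X + N%:R%:P)).[k%:R])); last first.
  by move=> k _; rewrite horner_comp !hornerE natrD.
rewrite sum_coef_XsubC1_exp_mul; [|by rewrite size_comp_poly2 ?size_XaddC|]; last first.
  apply: leq_trans (size_polyMleq _ _) _.
  by rewrite -polyC1 size_exp_XsubC /= [in X in (_ <= X)%N]addnC -addnS leq_add2l.
rewrite sub0r mul1r coef_XsubC1_exp_mul_lead // gap_poly_end // phim.
have sgn : (-1) ^+ N.-1 * (-1) ^+ N = -1 :> F.
  by case: (N) N0 => // n _; rewrite exprS /= mulrCA -exprMn mulrNN mulr1 expr1n mulr1.
rewrite [_ * _%:R * (-1) ^+ N]mulrAC sgn mulN1r !mulrN opprK !natrM.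
field; rewrite !pnatr_eq0 -!lt0n ffact_gt0 fact_gt0; lia.
Qed.

(** Every competitor (X - 1)^N h, the minimizer G included, has the same pairing E with G. Hence its
    squared distance to G is its squared norm minus E, and this is nonnegative. *)
Lemma extremal_poly_exists {C : numClosedFieldType} (m N : nat) : (0 < N)%N ->
  let E : C := ((m + 2 * N) ^_ N)%:R / ((m + N) ^_ N)%:R in
  exists P : {poly C}, [/\ P \is monic, size P = m.+1,
    P`_0 = N%:R / (m + N)%:R,
    \sum_(k < (m + N).+1) `|(('X - 1) ^+ N * P)`_k| ^+ 2 = E &
    forall h : {poly C}, h \is monic -> size h = m.+1 ->
      E <= \sum_(k < (m + N).+1) `|(('X - 1) ^+ N * h)`_k| ^+ 2].
Proof.
move=> N0 E; have [P [Pm sP P0 Pr PE]] := @dual_poly_exists C m N N0.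
pose G := ('X - 1) ^+ N * P.
have aG (h : {poly C}) : h \is monic -> size h = m.+1 ->
    \sum_(k < (m + N).+1) (('X - 1) ^+ N * h)`_k * G`_k = E.
  move=> hm sh; rewrite PE ?sh //; move: hm; rewrite monicE lead_coefE sh /= => /eqP->.
  by rewrite mul1r.
have GR k : (G`_k)^* = G`_k.
  have Pc : map_poly Num.conj P = P.
    by apply/polyP => j; rewrite coef_map /= (conj_Creal (Pr j)).
  by rewrite -coef_map rmorphM rmorphXn rmorphB /= map_polyX rmorph1 Pc.
exists P; split => //.
  by rewrite -(aG P Pm sP); apply: eq_bigr => k _; rewrite normCK GR.
move=> h hm sh; set a := _ * h.
have ER : E \is Num.real by rewrite rpred_div // realn.
suff : \sum_(k < (m + N).+1) `|a`_k - G`_k| ^+ 2 =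
       \sum_(k < (m + N).+1) `|a`_k| ^+ 2 - E.
  by rewrite -subr_ge0 => <-; apply: sumr_ge0 => k _; rewrite exprn_ge0.
have aGc : \sum_(k < (m + N).+1) (a`_k)^* * G`_k = E.
  rewrite -(conj_Creal ER) -(aG h hm sh) rmorph_sum; apply: eq_bigr => k _.
  by rewrite rmorphM /= GR.
(* The three copies of E stand for the two cross terms and the squared norm of G. *)
transitivity (\sum_(k < (m + N).+1) `|a`_k| ^+ 2 - E - E + E); last by rewrite addrNK.
rewrite -{1}(aG h hm sh) -{1}aGc -(aG P Pm sP) -!sumrN -!big_split /=.
by apply: eq_bigr => k _; rewrite !normCK rmorphB /= GR; ring.
Qed.

(** * Coefficients and values on the unit circle *)

(** X^n - 1 is separable in characteristic 0, and its n distinct roots must include a primitive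
    one. *)
Lemma prim_root_exists (C : numClosedFieldType) (n : nat) :
  (0 < n)%N -> exists z : C, n.-primitive_root z.
Proof.
move=> n0; have [r Dp] := closed_field_poly_normal ('X^n - 1 : {poly C}).
rewrite (monicP _) ?monicXnsubC // scale1r in Dp.
have rn1 : all n.-unity_root r by apply/allP => z; rewrite -root_prod_XsubC -Dp.
have szr : (n < (size r).+1)%N.
  by rewrite -(size_prod_XsubC r id) -Dp size_XnsubC.
have [|z _ zP] := hasP (has_prim_root n0 rn1 _ szr); last by exists z.
by rewrite -separable_prod_XsubC -Dp separable_Xn_sub_1 // pnatr_eq0 -lt0n.
Qed.

(** For deg p < n, averaging |p|^2 over the n-th roots of unity gives exactly the sum of squares: a
    discrete Parseval identity replaces the integral. *)
Lemma bessel_unit_circle {C : numClosedFieldType} (n : nat) (p : {poly C}) (B : C) :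
  (size p <= n)%N -> (forall z, `|z| = 1 -> `|p.[z]| <= B) ->
  \sum_(k < n) `|p`_k| ^+ 2 <= B ^+ 2.
Proof.
move=> sp pB.
have B0 : 0 <= B by apply: le_trans (pB 1 _); rewrite ?normr1.
have [->|n0] := posnP n; first by rewrite big_ord0 exprn_ge0.
have [w wP] := prim_root_exists C n n0.
have w1 : `|w| = 1.
  apply: (@pexpIrn _ n); rewrite ?nnegrE ?normr_ge0 ?ler01 //.
  by rewrite -normrX (prim_expr_order wP) normr1 expr1n.
have wconj l : w ^+ l * (w ^+ l)^* = 1 by rewrite -normCK normrX w1 !expr1n.
have orth (k l : 'I_n) :
    \sum_(j < n) w ^+ j ^+ k * (w ^+ j ^+ l)^* = (k == l)%:R * n%:R :> C.
  (* The sum is geometric with ratio u, an n-th root of unity that is 1 only if k = l. *)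
  pose u := w ^+ k * (w ^+ l)^*.
  rewrite (eq_bigr (fun j : 'I_n => u ^+ j)) => [|j _]; last first.
    by rewrite exprMn !rmorphXn /= -!exprM !(mulnC j).
  have [kl|kl] := eqVneq k l.
    rewrite (eq_bigr (fun=> 1)) => [|j _]; last by rewrite /u kl wconj expr1n.
    by rewrite sumr_const card_ord mul1r.
  have u1 : u != 1.
    apply: contra kl => /eqP uE.
    have /eqP : w ^+ k = w ^+ l.
      have : u * w ^+ l = w ^+ l by rewrite uE mul1r.
      by rewrite /u -mulrA [_^* * _]mulrC wconj mulr1.
    by rewrite (eq_prim_root_expr wP) !modn_small.
  have un : u ^+ n = 1.
    by rewrite exprMn -rmorphXn /= -!exprM ![(_ * n)%N]mulnC !exprM
      (prim_expr_order wP) !expr1n rmorph1 mulr1.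
  have := subrX1 u n; rewrite un subrr => /esym/eqP.
  by rewrite mulf_eq0 subr_eq0 (negPf u1) mul0r => /eqP.
have E : \sum_(j < n) `|p.[w ^+ j]| ^+ 2 = n%:R * \sum_(k < n) `|p`_k| ^+ 2.
  transitivity (\sum_(k < n) \sum_(l < n) \sum_(j < n)
      p`_k * (p`_l)^* * (w ^+ j ^+ k * (w ^+ j ^+ l)^*)).
    transitivity (\sum_(j < n) \sum_(k < n) \sum_(l < n)
      p`_k * (p`_l)^* * (w ^+ j ^+ k * (w ^+ j ^+ l)^*)).
      apply: eq_bigr => j _; rewrite normCK (horner_coef_wide _ sp) rmorph_sum big_distrl /=.
      apply: eq_bigr => k _; rewrite big_distrr; apply: eq_bigr => l _ /=.
      by rewrite rmorphM /=; ring.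
    rewrite exchange_big; apply: eq_bigr => k _ /=.
    by rewrite exchange_big.
  rewrite mulr_sumr; apply: eq_bigr => k _.
  rewrite (bigD1 k) //= [X in _ + X]big1 ?addr0 => [|l lk]; rewrite -mulr_sumr orth.
    by rewrite eqxx mul1r normCK mulrC.
  by rewrite eq_sym (negPf lk) mul0r mulr0.
have n0' : 0 < n%:R :> C by rewrite ltr0n.
rewrite -(ler_pM2l n0') -E.
apply: le_trans (_ : \sum_(j < n) B ^+ 2 <= _).
  apply: ler_sum => j _; rewrite lerXn2r ?nnegrE // pB //.
  by rewrite normrX w1 expr1n.
by rewrite sumr_const card_ord mulr_natl.
Qed.

(** * Exponential bounds for the minimal norm *)

(** The function (1 + y) e^(-y) - (1 - y) e^y vanishes at 0 and has derivative y (e^y - e^(-y)) >= 0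
    for y >= 0. *)
Lemma expR2_le_cayley {R : realType} (x : R) : 0 <= x < 1 ->
  expR (2 * x) <= (1 + x) / (1 - x).
Proof.
move=> /andP[x0 x1].
pose f (y : R) := (1 + y) * expR (- y) - (1 - y) * expR y.
have fd (y : R) : is_derive y 1 f (y * (expR y - expR (- y))).
  by apply: is_derive_eq; rewrite /GRing.scale /=; ring.
have f0 : 0 <= f x.
  have -> : 0 = f 0 by rewrite /f oppr0 expR0; ring.
  apply: (@ger0_derive1_ndecr R f 0 x) => //.
  - move=> y yx; rewrite derive1E derive_val mulr_ge0 //.
      by move: yx; rewrite in_itv /= => /andP[/ltW].
    rewrite subr_ge0 ler_expR; move: yx; rewrite in_itv /= => /andP[y0 _]; lra.
  - by apply: derivable_within_continuous => y _.
rewrite ler_pdivlMr ?subr_gt0 // mulr2n mulrDl mul1r expRD -mulrA.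
rewrite -(ler_pM2l (expR_gt0 (- x))) !mulrA -expRD addNr expR0 mul1r.
by move: f0; rewrite /f subr_ge0 mulrC [X in _ <= X]mulrC.
Qed.

Lemma ffact_ratioS {R : numFieldType} (n N : nat) : (N < n)%N ->
  ((n + N.+1) ^_ N.+1)%:R / (n ^_ N.+1)%:R =
  ((n + N) ^_ N)%:R / (n ^_ N)%:R * ((n + N).+1%:R / (n%:R - N%:R)) :> R.
Proof.
move=> Nn; rewrite addnS ffactSS ffactnSr !natrM natrB ?(ltnW Nn) //; field.
rewrite subr_eq0 !pnatr_eq0 eqr_nat -lt0n ffact_gt0; lia.
Qed.

(** With x = (N + 1/2) / (n + 1/2), the factor (n + N + 1) / (n - N) gained from N to N + 1 is
    exactly (1 + x) / (1 - x). The exponents 2x add up to N^2 / (n + 1/2). *)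
Lemma ffact_ratio_ge {R : realType} (n N : nat) : (N <= n)%N ->
  expR (N%:R ^+ 2 / (n%:R + 2^-1)) <= ((n + N) ^_ N)%:R / (n ^_ N)%:R :> R.
Proof.
elim: N => [|N IHN] Nn; first by rewrite expr0n mul0r expR0 !ffactn0 divr1.
rewrite ffact_ratioS //.
have -> : N.+1%:R ^+ 2 / (n%:R + 2^-1) =
    N%:R ^+ 2 / (n%:R + 2^-1) + 2 * ((N%:R + 2^-1) / (n%:R + 2^-1)) :> R.
  by rewrite -natr1; field; have := ler0n R n; lra.
have NR : (N%:R + 1 <= n%:R :> R) by rewrite natr1 ler_nat.
have N0 := ler0n R N.
rewrite expRD ler_pM ?expR_ge0 ?IHN ?(ltnW Nn) //.
apply: le_trans (expR2_le_cayley _ _) _.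
  by rewrite divr_ge0 ?ltr_pdivrMr ?mul1r; lra.
rewrite le_eqVlt; apply/orP; left; apply/eqP.
rewrite -[(n + N).+1%:R]natr1 natrD; field; lra.
Qed.

(** Each factor is 1 + (2N + 1) / (n - N) <= exp ((2N + 1) / d) as long as n - N >= d, and the odd
    numbers add up to N^2. *)
Lemma ffact_ratio_le {R : realType} (n N d : nat) : (0 < d)%N -> (N + d <= n.+1)%N ->
  ((n + N) ^_ N)%:R / (n ^_ N)%:R <= expR (N%:R ^+ 2 / d%:R) :> R.
Proof.
move=> d0; elim: N => [|N IHN] Nn; first by rewrite expr0n mul0r expR0 !ffactn0 divr1.
rewrite ffact_ratioS; last lia.
have -> : N.+1%:R ^+ 2 / d%:R = N%:R ^+ 2 / d%:R + (2 * N%:R + 1) / d%:R :> R.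
  by rewrite -natr1; field; rewrite pnatr_eq0 -lt0n.
have NR : (N%:R + d%:R <= n%:R :> R) by rewrite -natrD ler_nat.
have N0 := ler0n R N; have dR : 0 < d%:R :> R by rewrite ltr0n.
rewrite expRD; apply: ler_pM; [by rewrite divr_ge0|by rewrite divr_ge0 //; lra|by apply: IHN; lia|].
apply: le_trans (expR_ge1Dx _).
rewrite ler_pdivrMr; last lra.
rewrite -natr1 natrD mulrDl mul1r -lerBlDl mulrAC ler_pdivlMr //.
apply: (@le_trans _ _ ((2 * N%:R + 1) * d%:R)); [|apply: ler_wpM2l]; lra.
Qed.

(** * Order of vanishing at 1 of a monic polynomial *)

Lemma cabsE {R : realType} (z : R[i]) : `|z| = (cabs z)%:C%C.
Proof. by rewrite /cabs normc_def. Qed.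

(** After taking logarithms the 1/2 costs a single ln B, independent of k, while the other terms
    grow linearly in k. *)
Lemma exp_growth_root {R : realType} (n N : nat) (B : R) : (0 < n)%N -> 0 < B ->
  (forall k, (0 < k)%N ->
    expR ((k * N)%:R ^+ 2 / ((k * n)%:R + 2^-1)) <= (B ^+ k) ^+ 2) ->
  N%:R ^+ 2 <= 2 * n%:R * ln B.
Proof.
move=> n0 B0 H; rewrite leNgt; apply/negP => lt.
have nR : 0 < n%:R :> R by rewrite ltr0n.
have {}H k : (0 < k)%N -> k%:R * (N%:R ^+ 2 - 2 * n%:R * ln B) <= ln B.
  move=> k0; have kR : 0 < k%:R :> R by rewrite ltr0n.
  have := H k k0; rewrite -{1}(lnK (x := (B ^+ k) ^+ 2)) ?posrE ?exprn_gt0 //.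
  rewrite ler_expR !lnXn ?exprn_gt0 // !natrM ler_pdivrMr; last by nra.
  rewrite -[ln B *+ k]mulr_natl -[_ *+ 2]mulr_natl -(ler_pM2l kR) => h.
  rewrite -(ler_pM2l kR); nra.
pose D := N%:R ^+ 2 - 2 * n%:R * ln B.
have D0 : 0 < D by rewrite /D subr_gt0.
have [k kB] : exists k : nat, ln B / D < k%:R.
  exists (Num.bound `|ln B / D|); apply: le_lt_trans (ler_norm _) _.
  exact: archi_boundP.
(* [H] asks for a positive index and k may be 0. *)
have : k.+1%:R * D <= ln B by apply: H.
rewrite leNgt => /negP; apply; rewrite -ltr_pdivrMr //.
by apply: lt_trans kB _; rewrite ltr_nat.
Qed.

(** Powers remove the 1/2 of [ffact_ratio_ge]: a^k has degree kn, bound B^k and a zero of order at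
    least kN at 1. *)
Lemma unit_circle_vanishing_bound {R : realType} (n N : nat) (a : {poly R[i]}) (B : R) :
  (0 < N)%N -> a \is monic -> size a = n.+1 -> ('X - 1) ^+ N %| a ->
  (forall z : R[i], `|z| = 1 -> `|a.[z]| <= B%:C%C) ->
  N%:R ^+ 2 <= 2 * n%:R * ln B.
Proof.
move=> N0 am sa /dvdpP[h ah] aB.
have X1 : ('X - 1 : {poly R[i]}) = 'X - 1%:P by [].
have XN : ('X - 1 : {poly R[i]}) ^+ N \is monic by rewrite X1; apply: monic_exp; apply: monicXsubC.
have hm : h \is monic by move: am; rewrite ah monicMr.
have sh : size h = (n - N).+1 /\ (N <= n)%N.
  have s1 : (size h + N)%N = n.+1.
    have := sa; rewrite ah size_Mmonic ?monic_neq0 // X1 size_exp_XsubC.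
    by rewrite addnS.
  have s2 : (0 < size h)%N by rewrite size_poly_gt0 monic_neq0.
  have Nn : (N <= n)%N by rewrite -ltnS -s1 -[X in (X < _)%N]add0n ltn_add2r.
  by split; rewrite // -(addnK N (size h)) s1 subSn.
case: sh => sh Nn.
have key k : (0 < k)%N ->
    expR ((k * N)%:R ^+ 2 / ((k * n)%:R + 2^-1)) <= (B ^+ k) ^+ 2.
  move=> k0; apply: le_trans (ffact_ratio_ge _ _ _) _; first by rewrite leq_mul2l Nn orbT.
  have shk : size (h ^+ k) = (k * (n - N)).+1.
    rewrite -[LHS]prednK ?size_exp ?sh /= 1?mulnC //.
    by rewrite size_poly_gt0 monic_neq0 ?monic_exp.
  have kN0 : (0 < k * N)%N by rewrite muln_gt0 k0.
  have e1 : (k * (n - N) + k * N = k * n)%N by rewrite -mulnDr subnK.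
  have e2 : (k * (n - N) + 2 * (k * N) = k * n + k * N)%N by lia.
  have [_ [_ _ _ _ /(_ _ (monic_exp _ hm) shk)]] := @extremal_poly_exists R[i] (k * (n - N)) _ kN0.
  have -> : ('X - 1) ^+ (k * N) * h ^+ k = a ^+ k by rewrite ah exprMn mulnC exprM mulrC.
  rewrite e1 e2 => /le_trans/(_ (bessel_unit_circle _ (a ^+ k) (B%:C%C ^+ k) _ _)).
  rewrite -rmorphXn -rmorphXn -!(rmorph_nat (real_complex R)) -fmorphV -rmorphM lecR; apply.
    by apply: leq_trans (leqSpred _) _; rewrite size_exp sa mulnC.
  move=> z z1; rewrite horner_exp normrX rmorphXn lerXn2r ?nnegrE ?aB //.
  by rewrite (le_trans (normr_ge0 a.[z])) ?aB.
have B0 : 0 <= B.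
  by rewrite -lecR (le_trans (normr_ge0 a.[1])) // aB // normr1.
(* If B were 0, the case k = 1 would bound an exponential by 0. *)
have B1 : 0 < B.
  rewrite lt_def B0 andbT; apply/eqP => Be.
  by have := key 1%N isT; rewrite Be expr1 expr0n leNgt expR_gt0.
by apply: exp_growth_root key => //; apply: leq_trans Nn.
Qed.

(** * Elementary estimates, roots and the supremum on the circle *)

(** Cauchy-Schwarz against the constant vector, by summing 2xy <= x^2 + y^2 over all pairs. *)
Lemma sqr_sum_le {R : realFieldType} (n : nat) (x : 'I_n -> R) :
  (\sum_i x i) ^+ 2 <= n%:R * \sum_i x i ^+ 2.
Proof.
have H : \sum_i \sum_j x i * x j <= \sum_i \sum_(j < n) (x i ^+ 2 + x j ^+ 2) / 2.
  apply: ler_sum => i _; apply: ler_sum => j _.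
  by rewrite ler_pdivlMr // -subr_ge0 (_ : _ - _ = (x i - x j) ^+ 2) ?sqr_ge0 //; ring.
rewrite expr2 big_distrl /=; under eq_bigr do rewrite big_distrr /=.
apply: le_trans H _; rewrite le_eqVlt; apply/orP; left; apply/eqP.
transitivity (\sum_(i < n) (n%:R * x i ^+ 2 + \sum_j x j ^+ 2) / 2).
  apply: eq_bigr => i _; rewrite -mulr_suml big_split /= sumr_const card_ord.
  by rewrite mulr_natl.
rewrite -mulr_suml big_split /= sumr_const card_ord -mulr_sumr -mulr_natl; by field.
Qed.

(** [ln] is 0 on nonpositive arguments, which is where 0 <= K enters. *)
Lemma ln_le_of_le_expR {R : realType} (x K : R) : 0 <= K -> x <= expR K -> ln x <= K.
Proof.
move=> K0 xK; have [x0|x0] := leP x 0; first by rewrite ln0.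
by rewrite -ler_expR lnK.
Qed.

Lemma roots_msE {R : realType} (f : {poly R[i]}) :
  f = lead_coef f *: \prod_(z <- roots_ms f) ('X - z%:P).
Proof. by rewrite /roots_ms; case: closed_field_poly_normal. Qed.

Lemma cabs_ge0 {R : realType} (z : R[i]) : 0 <= cabs z.
Proof. by rewrite -lecR -cabsE normr_ge0. Qed.

Lemma norm_horner_le_sum {R : numDomainType} (p : {poly R}) (z : R) :
  `|z| = 1 -> `|p.[z]| <= \sum_(k < size p) `|p`_k|.
Proof.
move=> z1; rewrite horner_coef; apply: le_trans (ler_norm_sum _ _ _) _.
by apply: ler_sum => k _; rewrite normrM normrX z1 expr1n mulr1.
Qed.

(** The sum of the moduli of the coefficients bounds f on the circle, so the [sup] is a genuine
    upper bound. *)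
Lemma cabs_horner_le_maxT {R : realType} (f : {poly R[i]}) (z : R[i]) :
  `|z| = 1 -> cabs f.[z] <= maxT f.
Proof.
move=> z1; apply: ub_le_sup; last by exists z => //=; rewrite /cabs z1.
exists (complex.Re (\sum_(k < size f) `|f`_k|)) => _ [w /= w1 <-].
have w1' : `|w| = 1 by rewrite cabsE w1.
by have := norm_horner_le_sum f w w1'; rewrite lecE => /andP[].
Qed.

Lemma expi_norm {R : realType} (theta : R) : `|expi theta| = 1.
Proof. by rewrite normc_def /= cos2Dsin2 sqrtr1. Qed.

(** * Normalizing the roots: the bound for N_theta *)

(** After multiplication by |w| the two sides differ by (1 - |w|)^2. *)
Lemma norm_sub_normalized_le {C : numClosedFieldType} (z w : C) : `|z| = 1 -> w != 0 ->
  `|z - w / `|w| | ^+ 2 <= `|z - w| ^+ 2 / `|w|.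
Proof.
move=> z1 w0; have r0 : 0 < `|w| by rewrite normr_gt0.
have rr : (w / `|w|)^* = w^* / `|w|.
  by rewrite rmorphM /= [X in _ * X]conj_Creal ?rpredV ?normr_real.
have zz : z * z^* = 1 by rewrite -normCK z1 expr1n.
have ww : w * w^* = `|w| ^+ 2 by rewrite normCK.
rewrite ler_pdivlMr // -subr_ge0.
have -> : `|z - w| ^+ 2 - `|z - w / `|w| | ^+ 2 * `|w| = (1 - `|w|) ^+ 2.
  rewrite !normCK !rmorphB /= rr.
  transitivity (z * z^* + w * w^* - (z * z^* * `|w| + w * w^* / `|w|)).
    by field; rewrite gt_eqF.
  by rewrite zz ww; field; rewrite gt_eqF.
by rewrite real_exprn_even_ge0 // rpredB ?rpred1 ?normr_real.
Qed.

Lemma height_bound {R : realType} (n N : nat) (theta : R) (f : {poly R[i]}) :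
  (0 < n)%N -> size f = n.+1 -> f`_0 != 0 -> (N <= Ntheta theta f)%N ->
  N%:R <= Num.sqrt 2 * Num.sqrt (height f) * n%:R.
Proof.
move=> n0 sf f0 Nf.
have [->|N0] := posnP N.
  by rewrite mulr_ge0 ?mulr_ge0 ?sqrtr_ge0.
suff H : N%:R ^+ 2 <= 2 * n%:R ^+ 2 * height f.
  have nR : 0 < n%:R :> R by rewrite ltr0n.
  (* [H] itself forces the height to be nonnegative, so its square root squares back to it. *)
  have h0 : 0 <= height f.
    have := le_trans (exprn_ge0 2 (ler0n R N)) H.
    by rewrite pmulr_rge0 // mulr_gt0 ?exprn_gt0.
  rewrite -(@ler_sqr _ N%:R) ?nnegrE ?ler0n ?mulr_ge0 ?sqrtr_ge0 //.
  rewrite !exprMn !sqr_sqrtr //; lra.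
set rs := roots_ms f; set e := expi theta.
have e1 : `|e| = 1 by apply: expi_norm.
have e0 : e != 0 by rewrite -normr_eq0 e1 oner_eq0.
have fE := roots_msE f; rewrite -/rs in fE.
have lc0 : lead_coef f != 0 by rewrite lead_coef_eq0 -size_poly_gt0 sf.
have rsn : size rs = n.
  by have := sf; rewrite {1}fE size_scale // size_prod_XsubC => -[].
have f0E : `|f`_0| = `|lead_coef f| * \prod_(z <- rs) `|z|.
  rewrite -horner_coef0 {1}fE hornerZ normrM horner_prod normr_prod; congr (_ * _).
  by apply: eq_bigr => z _; rewrite hornerXsubC sub0r normrN.
have rs0 z : z \in rs -> z != 0.
  move=> zr; apply: contra f0 => /eqP z0; rewrite -normr_eq0 f0E.
  by rewrite (big_rem z zr) /= z0 normr0 mul0r mulr0.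
(* The roots are projected to the unit circle, then rotated so that those on the ray become 1. *)
pose us := [seq z / `|z| / e | z <- rs].
pose a := \prod_(u <- us) ('X - u%:P).
have A0 : 0 < cabs (f`_0 * lead_coef f).
  by rewrite -ltcR -cabsE normr_gt0 mulf_neq0.
have aB z : `|z| = 1 -> `|a.[z]| <= (maxT f / Num.sqrt (cabs (f`_0 * lead_coef f)))%:C%C.
  move=> z1; have ez1 : `|e * z| = 1 by rewrite normrM e1 z1 mulr1.
  have M0 : 0 <= maxT f := le_trans (cabs_ge0 _) (cabs_horner_le_maxT f z z1).
  have B0 : 0 <= maxT f / Num.sqrt (cabs (f`_0 * lead_coef f)).
    by rewrite divr_ge0 ?sqrtr_ge0.
  rewrite -(@ler_pXn2r _ 2) ?nnegrE ?normr_ge0 ?ler0c //.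
  rewrite -[X in _ <= X]rmorphXn /= expr_div_n sqr_sqrtr ?(ltW A0) //.
  apply: (@le_trans _ _ (`|f.[e * z]| ^+ 2 / `|f`_0 * lead_coef f|)); last first.
    rewrite (cabsE f.[_]) (cabsE (_ * _)) -rmorphXn -fmorphV -rmorphM lecR.
    by rewrite ler_pM2r ?invr_gt0 // ler_pXn2r ?nnegrE ?cabs_ge0 // cabs_horner_le_maxT.
  (* Since |a_0 a_n| is |a_n|^2 times the product of the |w|, the quotient splits root by root. *)
  have -> : `|f.[e * z]| ^+ 2 / `|f`_0 * lead_coef f| =
            \prod_(w <- rs) (`|e * z - w| ^+ 2 / `|w|).
    rewrite normrM f0E {1}fE hornerZ normrM horner_prod normr_prod.
    rewrite big_split /= prodfV prodrXl exprMn.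
    rewrite (eq_bigr (fun w => `|e * z - w|)) => [|w _]; last by rewrite hornerXsubC.
    have : \prod_(w <- rs) `|w| != 0.
      by rewrite prodf_seq_neq0; apply/allP => w wr /=; rewrite normr_eq0 rs0.
    have : `|lead_coef f| != 0 by rewrite normr_eq0.
    move: `|lead_coef f| (\prod_(w <- rs) `|w|) => L Q L0 Q0.
    by field; rewrite Q0 L0.
  rewrite /a big_map horner_prod normr_prod -prodrXl !big_seq.
  apply: ler_prod => w wr; rewrite exprn_ge0 //=.
  apply: le_trans _ (norm_sub_normalized_le _ _ ez1 (rs0 w wr)).
  have -> : e * z - w / `|w| = e * (z - w / `|w| / e) by rewrite mulrBr [e * (_ / e)]mulrC divfK.
  by rewrite hornerXsubC normrM e1 mul1r.
have XN : ('X - 1) ^+ N %| a.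
  rewrite -polyC1 -mup_geq ?monic_neq0 ?monic_prod_XsubC // mu_prod_XsubC.
  apply: leq_trans Nf _; rewrite count_map; apply: sub_count => z /asboolP[r r0 ->] /=.
  have rC : 0 < r%:C%C by rewrite ltcE /= eqxx.
  by rewrite normrM e1 mulr1 gtr0_norm // -mulrA -invfM divff // mulf_neq0 // gt_eqF.
have aS : size a = n.+1 by rewrite size_prod_XsubC size_map rsn.
have := unit_circle_vanishing_bound _ _ _ _ N0 (monic_prod_XsubC _ _ _) aS XN aB.
rewrite /height sf /=; have : n%:R != 0 :> R by rewrite pnatr_eq0 -lt0n.
set l := ln _ => nR h; apply: le_trans h _.
by rewrite le_eqVlt; apply/orP; left; apply/eqP; field.
Qed.

(** * Sharpness of the constant *)

Lemma count_roots_ms_ge {R : realType} (f : {poly R[i]}) (N : nat) (e : R[i]) :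
  f != 0 -> ('X - e%:P) ^+ N %| f -> (N <= count_mem e (roots_ms f))%N.
Proof.
move=> f0; rewrite {1}(roots_msE f) dvdpZr ?lead_coef_eq0 //.
by rewrite -mup_geq ?monic_neq0 ?monic_prod_XsubC // mu_prod_XsubC.
Qed.

(** The polynomial is the minimizer, rotated so that its zero at 1 moves onto the ray. The first
    term bounds its L^2 norm, by [ffact_ratio_le] with d = m + 1; the logarithm pays for passing to
    the maximum and for |a_0 / a_n| = N / n. *)
Lemma low_height_poly_exists {R : realType} (theta : R) (m N : nat) : (0 < N)%N ->
  exists f : {poly R[i]}, [/\ size f = (m + N).+1, f`_0 != 0,
    (N <= Ntheta theta f)%N &
    (m + N)%:R * height f <= N%:R ^+ 2 / (2 * m.+1%:R) + ln (m + N).+1%:R].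
Proof.
move=> N0; have [P [Pm sP P0 PE _]] := @extremal_poly_exists R[i] m N N0.
set n := (m + N)%N in P0 PE *; set e := expi theta.
have n0 : (0 < n)%N by rewrite addn_gt0 N0 orbT.
have e1 : `|e| = 1 by apply: expi_norm.
have e0 : e != 0 by rewrite -normr_eq0 e1 oner_eq0.
pose G := ('X - 1) ^+ N * P.
have XN : ('X - 1 : {poly R[i]}) ^+ N \is monic.
  by rewrite -polyC1; apply: monic_exp; apply: monicXsubC.
have Gm : G \is monic by rewrite monicMr.
have sG : size G = n.+1.
  by rewrite size_monicM ?monic_neq0 // -polyC1 size_exp_XsubC sP addSn /= addnC.
pose q : {poly R[i]} := e^-1 *: 'X.
have sq : size q = 2 by rewrite size_scale ?size_polyX // invr_eq0.
pose f := G \Po q.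
have sf : size f = n.+1 by rewrite size_comp_poly2.
have fz z : f.[z] = G.[e^-1 * z] by rewrite horner_comp hornerZ hornerX.
have f0E : f`_0 = (-1) ^+ N * (N%:R / n%:R).
  rewrite -horner_coef0 fz mulr0 hornerM [P.[0]]horner_coef0 P0.
  by rewrite horner_exp !hornerE.
have lcE : `|lead_coef f| = 1.
  rewrite lead_coef_comp ?sq // (monicP Gm) mul1r lead_coefZ lead_coefX mulr1.
  by rewrite normrX normfV e1 invr1 expr1n.
have A0 : cabs (f`_0 * lead_coef f) = N%:R / n%:R.
  apply: (@complexI R); rewrite -cabsE normrM lcE mulr1 f0E normrM normrX normrN1 expr1n mul1r.
  by rewrite rmorphM fmorphV !rmorph_nat ger0_norm.
pose E : R := ((m + 2 * N) ^_ N)%:R / (n ^_ N)%:R.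
have GE : \sum_(k < n.+1) cabs G`_k ^+ 2 = E.
  apply: (@complexI R); rewrite rmorph_sum rmorphM fmorphV !rmorph_nat -PE.
  by apply: eq_bigr => k _; rewrite rmorphXn /= -cabsE.
have fM : maxT f ^+ 2 <= n.+1%:R * E.
  have M0 : 0 <= maxT f by apply: le_trans (cabs_ge0 _) (cabs_horner_le_maxT f 1 (normr1 _)).
  have S0 : 0 <= \sum_(k < n.+1) cabs G`_k by apply: sumr_ge0 => k _; apply: cabs_ge0.
  apply: (@le_trans _ _ ((\sum_(k < n.+1) cabs G`_k) ^+ 2)); last by rewrite -GE sqr_sum_le.
  rewrite ler_sqr ?nnegrE //; apply: ge_sup.
    by exists (cabs f.[1]), 1 => //=; rewrite /cabs normr1.
  move=> _ [w /= w1 <-].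
  have w1' : `|e^-1 * w| = 1 by rewrite normrM normfV e1 invr1 mul1r cabsE w1.
  have := norm_horner_le_sum G _ w1'; rewrite -fz sG cabsE.
  rewrite (eq_bigr (fun k : 'I__ => (cabs G`_k)%:C%C)) => [|k _]; last exact: cabsE.
  by rewrite -rmorph_sum lecR.
exists f; split => //.
- rewrite -normr_eq0 f0E normrM normrX normrN1 expr1n mul1r normr_eq0.
  by rewrite mulf_neq0 ?invr_eq0 ?pnatr_eq0 -?lt0n.
- apply: leq_trans (count_roots_ms_ge f N e _ _) _.
  + by rewrite -size_poly_gt0 sf.
  + rewrite /f /G comp_polyM dvdp_mulr //.
    rewrite rmorphXn /= comp_polyB comp_polyX -polyC1 comp_polyC.
    have -> : q - 1%:P = e^-1 *: ('X - e%:P).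
      by rewrite scalerBr -[_ *: _%:P]mul_polyC -polyCM mulVf.
    by rewrite exprZn dvdpZr ?dvdpp // expf_neq0 // invr_eq0.
  + apply: sub_count => z /= /eqP->; apply/asboolP; exists 1 => //.
    by rewrite rmorph1 mul1r.
rewrite /height sf /= A0 mulVKf ?pnatr_eq0 -?lt0n //.
set K := _ + _.
have n1 : 1 <= n.+1%:R :> R by rewrite ler1n.
have K0 : 0 <= K by rewrite addr_ge0 ?ln_ge0 // divr_ge0 ?exprn_ge0 ?mulr_ge0.
apply: ln_le_of_le_expR => //.
have nR : 0 < n%:R :> R by rewrite ltr0n.
have NR : 0 < N%:R :> R by rewrite ltr0n.
have x0 : 0 <= maxT f / Num.sqrt (N%:R / n%:R).
  by rewrite divr_ge0 ?sqrtr_ge0 // (le_trans (cabs_ge0 f.[1])) // cabs_horner_le_maxT ?normr1.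
rewrite -ler_sqr ?nnegrE ?expR_ge0 // expr_div_n sqr_sqrtr ?divr_ge0 //.
rewrite -expRM_natr.
(* One logarithm is for Cauchy-Schwarz on n + 1 coefficients, the other for the division by N / n,
   which costs a factor of at most n + 1. *)
have -> : K * 2%:R = N%:R ^+ 2 / m.+1%:R + (ln n.+1%:R + ln n.+1%:R).
  have : m.+1%:R != 0 :> R by rewrite pnatr_eq0.
  by rewrite /K; move: (m.+1%:R) (ln _) => d l d0; field.
rewrite !expRD !lnK ?posrE ?ltr0n //.
have EB : E <= expR (N%:R ^+ 2 / m.+1%:R).
  rewrite /E (_ : m + 2 * N = n + N)%N; last by rewrite /n; lia.
  by apply: ffact_ratio_le => //; rewrite /n; lia.
rewrite ler_pdivrMr ?divr_gt0 //; apply: le_trans fM _.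
have E0 : 0 <= E by rewrite divr_ge0.
have N1 : 1 <= N%:R :> R by rewrite ler1n.
have h : 1 <= n.+1%:R * (N%:R / n%:R) :> R.
  by rewrite mulrA ler_pdivlMr // -natr1; nra.
rewrite [n.+1%:R * E]mulrC -[X in _ <= X]mulrA -[X in _ <= _ * X]mulrA.
by apply: ler_pM => //; rewrite ler_peMr.
Qed.

(** For n = (l + 1) N the main term is at most (c^2 / 2) (1 + 1/l) N^2, below N^2 once l is large; a
    large N then absorbs the logarithm. *)
Lemma exists_sharp_parameters {R : realType} (c : R) : 0 < c -> c < Num.sqrt 2 ->
  exists m N : nat, (0 < N)%N /\
    c ^+ 2 * (m + N)%:R * (N%:R ^+ 2 / (2 * m.+1%:R) + ln (m + N).+1%:R) < N%:R ^+ 2.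
Proof.
move=> c0 c2.
have cc : c ^+ 2 < 2.
  by rewrite -[ltRHS](@sqr_sqrtr _ 2) // ltr_pXn2r ?nnegrE ?sqrtr_ge0 ?ltW.
have cp : 0 < c ^+ 2 by rewrite exprn_gt0.
move: (c ^+ 2) cc cp => b b2 b0.
(* This choice makes (b / 2) (1 + 1/l) < 1; the gap d is the room left for the logarithmic term. *)
have [l lb] : exists l : nat, b / (2 - b) < l%:R.
  by exists (Num.bound (b / (2 - b))); apply: archi_boundP; rewrite divr_ge0 //; lra.
have l0 : 0 < l%:R :> R by apply: le_lt_trans lb; rewrite divr_ge0 //; lra.
pose d := 1 - b / 2 * (1 + l%:R^-1).
have d0 : 0 < d.
  have : b < l%:R * (2 - b) by rewrite -ltr_pdivrMr //; lra.
  rewrite /d => h; rewrite -(pmulr_rgt0 _ l0).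
  rewrite (_ : _ * _ = (l%:R * (2 - b) - b) / 2); first by rewrite divr_gt0 // subr_gt0.
  by field; rewrite gt_eqF.
(* M is such that b (l + 1) (l + 4) M < d M^2, where (l + 4) M bounds l + 1 + 2M. *)
have [M Mb] : exists M : nat, b * (l%:R + 1) * (l%:R + 4) / d < M%:R.
  eexists; apply: archi_boundP; rewrite divr_ge0 ?(ltW d0) // !mulr_ge0 ?addr_ge0 //; lra.
have M0 : 0 < M%:R :> R.
  by apply: le_lt_trans Mb; rewrite divr_ge0 ?(ltW d0) // !mulr_ge0 ?addr_ge0 //; lra.
have M1 : 1 <= M%:R :> R by rewrite ler1n -(ltr0n R).
(* Taking N = M^2 makes ln N = 2 ln M <= 2M visibly negligible against N. *)
exists (l * M ^ 2)%N, (M ^ 2)%N; split; first by rewrite expn_gt0 -(ltr0n R) M0.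
have l2 : 0 < 1 + (l%:R + 1) :> R by lra.
have M2 : 0 < M%:R ^+ 2 :> R by rewrite exprn_gt0.
have lM2 : 0 < (1 + (l%:R + 1)) * M%:R ^+ 2 :> R by rewrite mulr_gt0.
have lnB : ln (l * M ^ 2 + M ^ 2).+1%:R <= l%:R + 1 + 2 * M%:R :> R.
  apply: (@le_trans _ _ (ln ((1 + (l%:R + 1)) * M%:R ^+ 2))).
    rewrite ler_ln ?posrE ?ltr0n //.
    rewrite -natr1 natrD natrM natrX; nra.
  rewrite lnM ?posrE //.
  rewrite lnXn // -[_ *+ 2]mulr_natl lerD ?le_ln1Dx //; first lra.
  by rewrite ler_pM2l // ltW // ln_sublinear.
have q : (M ^ 2)%:R ^+ 2 / (2 * (l * M ^ 2).+1%:R) <= M%:R ^+ 2 / (2 * l%:R) :> R.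
  rewrite natrX ler_pdivrMr ?mulr_gt0 // -[(l * _).+1%:R]natr1 natrM natrX.
  rewrite mulrAC ler_pdivlMr ?mulr_gt0 //.
  have := exprn_ge0 2 (ltW M0); move: (M%:R ^+ 2) => y y0; nra.
apply: (@le_lt_trans _ _ (b * ((l%:R + 1) * M%:R ^+ 2) *
    (M%:R ^+ 2 / (2 * l%:R) + (l%:R + 1 + 2 * M%:R)))).
  rewrite natrD natrM natrX -[X in _ + X]mul1r -mulrDl.
  apply: ler_wpM2l; first by rewrite !mulr_ge0 ?addr_ge0 ?exprn_ge0 // ltW.
  by apply: lerD => //; move: q; rewrite natrX.
have -> : (M ^ 2)%:R ^+ 2 = M%:R ^+ 2 * M%:R ^+ 2 :> R by rewrite natrX -expr2.
rewrite -subr_gt0.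
have -> : M%:R ^+ 2 * M%:R ^+ 2 - b * ((l%:R + 1) * M%:R ^+ 2) *
    (M%:R ^+ 2 / (2 * l%:R) + (l%:R + 1 + 2 * M%:R)) =
  M%:R ^+ 2 * (d * M%:R ^+ 2 - b * (l%:R + 1) * (l%:R + 1 + 2 * M%:R)).
  by rewrite /d; field; rewrite gt_eqF.
rewrite mulr_gt0 ?exprn_gt0 // subr_gt0.
move: Mb; rewrite ltr_pdivrMr // => Mb.
apply: (@le_lt_trans _ _ (b * (l%:R + 1) * (l%:R + 4) * M%:R)).
  rewrite -!mulrA; apply: ler_wpM2l; first exact: ltW.
  by apply: ler_wpM2l; nra.
by rewrite expr2 mulrA ltr_pM2r // [X in _ < X]mulrC.
Qed.

Lemma sharp_poly_exists {R : realType} (c theta : R) : c < Num.sqrt 2 ->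
  exists (n : nat) (f : {poly R[i]}), [/\ (1 <= n)%N, size f = n.+1, f`_0 != 0 &
    c * Num.sqrt (height f) * n%:R < (Ntheta theta f)%:R].
Proof.
move=> c2; have [c0|c0] := ltP 0 c; last first.
  (* For c <= 0 the left side is nonpositive, so any polynomial with a root on the ray will do; here
     n = 1. *)
  have [f [sf f0 fN _]] := low_height_poly_exists theta 0 1 isT.
  exists 1%N, f; split => //.
  apply: (@le_lt_trans _ _ 0); last by rewrite ltr0n.
  by rewrite mulr1 mulr_le0_ge0 // sqrtr_ge0.
have [m [N [N0 mN]]] := exists_sharp_parameters c c0 c2.
have [f [sf f0 fN fh]] := low_height_poly_exists theta m N N0.
exists (m + N)%N, f; split => //; first by rewrite addn_gt0 N0 orbT.
apply: lt_le_trans (_ : N%:R <= _); last by rewrite ler_nat.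
have n0 : 0 < (m + N)%:R :> R by rewrite ltr0n addn_gt0 N0 orbT.
rewrite -ltr_sqr ?nnegrE ?ler0n ?mulr_ge0 ?sqrtr_ge0 ?(ltW c0) //.
(* [Num.sqrt] is 0 at a nonpositive height, so only a positive one can be squared back. *)
have [h0|h0] := leP (height f) 0.
  by rewrite ler0_sqrtr // mulr0 mul0r expr0n exprn_gt0 // ltr0n.
rewrite !exprMn sqr_sqrtr ?(ltW h0) //; apply: le_lt_trans mN.
rewrite -[X in X <= _]mulrA -[X in _ <= X]mulrA.
apply: ler_wpM2l; first exact: exprn_ge0 _ (ltW c0).
rewrite expr2 mulrCA; apply: ler_wpM2l; first exact: ltW.
by rewrite mulrC.
Qed.

(** * The real half-lines as the rays theta = 0 and theta = 1/2, and the theorem *)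

Lemma Npos_Ntheta {R : realType} (f : {poly R[i]}) : Npos f = Ntheta 0 f.
Proof.
apply: eq_count => z; rewrite /on_ray /expi mulr0 cos0 sin0.
apply/andP/asboolP => [[/eqP iz rz]|[r r0 ->]].
  by exists (complex.Re z) => //; case: z iz {rz} => a b /= ->; rewrite mulr1.
by rewrite mulr1 /= eqxx.
Qed.

Lemma Nneg_Ntheta {R : realType} (f : {poly R[i]}) : Nneg f = Ntheta 2^-1 f.
Proof.
apply: eq_count => z; rewrite /on_ray /expi [2 * pi]mulrC mulfK // cospi sinpi.
apply/andP/asboolP => [[/eqP iz rz]|[r r0 ->]].
  exists (- complex.Re z); rewrite ?oppr_gt0 //; case: z iz {rz} => a b /= ->.
  by apply/eqP; rewrite eq_complex /= !(mulr0, mul0r, subr0, addr0) mulrNN mulr1 !eqxx.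
by rewrite /= !(mulr0, mul0r, subr0, addr0) eqxx mulrN1 oppr_lt0.
Qed.

Theorem theorem1p2 (R : realType) :
  (forall (n : nat) (f : {poly R[i]}), (1 <= n)%N -> size f = n.+1 ->
     f`_0 != 0 ->
     (forall theta : R,
        (Ntheta theta f)%:R <= Num.sqrt 2 * Num.sqrt (height f) * n%:R)
     /\ (Npos f)%:R <= Num.sqrt 2 * Num.sqrt (height f) * n%:R
     /\ (Nneg f)%:R <= Num.sqrt 2 * Num.sqrt (height f) * n%:R)
  /\
  (forall c : R, c < Num.sqrt 2 ->
     (forall theta : R, exists (n : nat) (f : {poly R[i]}),
        [/\ (1 <= n)%N, size f = n.+1, f`_0 != 0 &
            c * Num.sqrt (height f) * n%:R < (Ntheta theta f)%:R])
     /\ (exists (n : nat) (f : {poly R[i]}),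
        [/\ (1 <= n)%N, size f = n.+1, f`_0 != 0 &
            c * Num.sqrt (height f) * n%:R < (Npos f)%:R])
     /\ (exists (n : nat) (f : {poly R[i]}),
        [/\ (1 <= n)%N, size f = n.+1, f`_0 != 0 &
            c * Num.sqrt (height f) * n%:R < (Nneg f)%:R])).
Proof.
split=> [n f n0 sf f0|c c2].
  have bound theta := height_bound n _ theta f n0 sf f0 (leqnn _).
  by rewrite Npos_Ntheta Nneg_Ntheta.
split; first by move=> theta; apply: sharp_poly_exists.
split.
  have [n [f [n0 sf f0 fN]]] := sharp_poly_exists c 0 c2.
  by exists n, f; rewrite Npos_Ntheta.
have [n [f [n0 sf f0 fN]]] := sharp_poly_exists c 2^-1 c2.
by exists n, f; rewrite Nneg_Ntheta.
Qed.
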